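(* Let $n$ be a positive integer, and consider integer tuples $(p,q,r,k,l,\alpha,\beta,\gamma)$ with $p,q,r,k,l\ge1$, $(p+q)k+(r+q)l=n$, $0\le\alpha<k$, $0\le\beta<k+l$ and $0\le\gamma<l$. Among these, let $S_1=\{k<l\}$, $S_2=\{k=l,\ p<r\}$, $S_3=\{k=l,\ p=r,\ \alpha\le\gamma\}$. Then $\Sigma_D=S_1\cup S_2\cup S_3$ uniquely parametrizes the $n$-square surfaces in $\mathcal H(1,1)$ with cylinder diagram $D$: every such surface is isomorphic to the surface with parameters $v$ for exactly one $v\in\Sigma_D$.
   Context: An $n$-square surface is a connected closed oriented surface obtained from $n$ unit axis-parallel squares by gluing right sides to left sides and top sides to bottom sides by translations; two are isomorphic if there is a bijection of their squares respecting right-neighbours and top-neighbours. It is in $\mathcal H(1,1)$ if it has exactly two cone points, each of angle $4\pi$. The surface with parameters $(p,q,r,k,l,\alpha,\beta,\gamma)$: take three horizontal cylinders (rectangles with vertical sides identified), $C_1$ of circumference $k$ and height $p$, $C_2$ of circumference $k+l$ and height $q$, $C_3$ of circumference $l$ and height $r$. There are four horizontal segments: $k_1,k_2$ of length $k$ and $l_1,l_2$ of length $l$. Bottom of $C_2$, going right from $x=0$: $k_2,l_2$. Top of $C_2$, going right from $x=\beta$ (mod $k+l$): $k_1,l_1$. Bottom of $C_1$ from $x=0$: $k_1$; top of $C_1$ from $x=\alpha$ (mod $k$): $k_2$. Bottom of $C_3$ from $x=0$: $l_1$; top of $C_3$ from $x=\gamma$ (mod $l$): $l_2$. Glue top and bottom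 segments of the same name by translation. An $n$-square surface has cylinder diagram $D$ if it is isomorphic to a surface obtained this way. *)

(* Defs.v *)
From mathcomp Require Import all_boot perm.

Set Implicit Arguments.
Unset Strict Implicit.
Unset Printing Implicit Defensive.

(* Gluing data for unit squares: the right side of [s] is glued to the left
   side of [right_nbr S s], its top side to the bottom side of [top_nbr S s].
   The resulting surface is closed since both maps are permutations, and
   oriented since the gluings are translations. *)
Record gluing := Gluing {
  square :> finType;
  right_nbr : {perm square};
  top_nbr : {perm square}
}.

Definition adjacent (S : gluing) : rel S := fun s t =>
  [|| t == right_nbr S s, s == right_nbr S t,
      t == top_nbr S s | s == top_nbr S t].

Definition square_surface (n : nat) (S : gluing) : Prop :=
  #|S| = n /\ forall s t : S, connect (@adjacent S) s t.

Definition isomorphic (S T : gluing) : Prop :=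
  exists f : S -> T,
    [/\ bijective f,
        forall s, f (right_nbr S s) = right_nbr T (f s)
      & forall s, f (top_nbr S s) = top_nbr T (f s)].

(* [(s, a, b)] is a corner of the square [s]: [a] tells whether it lies on the
   right side of [s], and [b] whether it lies on the top side. *)
Definition corner (S : gluing) : finType := (S * bool * bool)%type.

Definition corner_glued (S : gluing) : rel (corner S) := fun c d =>
  let: (s, a, b) := c in
  let: (t, a', b') := d in
  [&& a, ~~ a', b == b' & t == right_nbr S s]
  || [&& b, ~~ b', a == a' & t == top_nbr S s].

Definition same_vertex (S : gluing) : rel (corner S) :=
  connect (fun c d => corner_glued c d || corner_glued d c).

Definition vertices (S : gluing) : {set {set corner S}} :=
  equivalence_partition (@same_vertex S) setT.

(* In units of pi / 2: every corner at the vertex contributes one such angle. *)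
Definition angle (S : gluing) (V : {set corner S}) : nat := #|V|.

(* A cone point is a vertex whose angle is not 2 pi. *)
Definition cone_points (S : gluing) : {set {set corner S}} :=
  [set V in vertices S | angle V != 4].

Definition in_H11 (S : gluing) : Prop :=
  #|cone_points S| = 2 /\ forall V, V \in cone_points S -> angle V = 8.

Record params := Params {
  height1 : nat;   (* p *)
  height2 : nat;   (* q *)
  height3 : nat;   (* r *)
  width1 : nat;    (* k *)
  width3 : nat;    (* l *)
  twist1 : nat;    (* alpha *)
  twist2 : nat;    (* beta *)
  twist3 : nat     (* gamma *)
}.

(* Squares are addressed by their column and row. The rows are indexed by
   ['I_h.-1.+1], which is ['I_h] for every height [h >= 1], so that the bottom
   row [ord0] and the top row [ord_max] always exist. *)
Definition cylinder (w h : nat) : finType := ('I_w * 'I_h.-1.+1)%type.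

Definition cylinders (v : params) : finType :=
  (cylinder (width1 v) (height1 v)
   + cylinder (width1 v + width3 v) (height2 v)
   + cylinder (width3 v) (height3 v))%type.

Notation C1 x y := (inl (inl (x, y))).
Notation C2 x y := (inl (inr (x, y))).
Notation C3 x y := (inr (x, y)).

(* The distance [(x - a) mod w] from the abscissa [a] to [x], going right. *)
Definition from_abscissa (w a : nat) (x : 'I_w) : 'I_w :=
  iter a (@ord_pred w) x.

Definition cyl_right (v : params) (s : cylinders v) : cylinders v :=
  match s with
  | C1 x y => C1 (ordS x) y
  | C2 x y => C2 (ordS x) y
  | C3 x y => C3 (ordS x) y
  end.

(* A column [t] of the segments k1, k2, l1, l2 is met at the abscissa [t] of
   the bottom of C1, of the bottom of C2, of the bottom of C3, and at the
   abscissa [k + t] of the bottom of C2, respectively. *)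
Definition cyl_top (v : params) (s : cylinders v) : cylinders v :=
  match s with
  | C1 x y =>
      if y != ord_max then C1 x (ordS y) else
      C2 (lshift (width3 v) (from_abscissa (twist1 v) x)) ord0
  | C2 x y =>
      if y != ord_max then C2 x (ordS y) else
      match split (from_abscissa (twist2 v) x) with
      | inl t => C1 t ord0
      | inr t => C3 t ord0
      end
  | C3 x y =>
      if y != ord_max then C3 x (ordS y) else
      C2 (rshift (width1 v) (from_abscissa (twist3 v) x)) ord0
  end.

Lemma cyl_right_inj v : injective (@cyl_right v).
Proof.
pose left (s : cylinders v) : cylinders v :=
  match s with
  | C1 x y => C1 (ord_pred x) y
  | C2 x y => C2 (ord_pred x) y
  | C3 x y => C3 (ord_pred x) y
  end.
by apply: (@can_inj _ _ _ left) => -[[[x y]|[x y]]|[x y]]; rewrite /= ordSK.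
Qed.

Lemma cyl_top_inj v : injective (@cyl_top v).
Proof.
have fromK w a : cancel (@from_abscissa w a) (iter a (@ordS w)).
  elim: a => // a IHa x; rewrite iterSr /from_abscissa iterS ord_predK.
  exact: IHa.
have ordS0 n (y : 'I_n.+1) : y != ord_max -> (ordS y == ord0) = false.
  move=> y_max; rewrite -val_eqE /= modn_small // ltnS ltn_neqAle.
  by rewrite -[y <= n]ltnS ltn_ord andbT.
pose bottom (s : cylinders v) : cylinders v :=
  match s with
  | C1 x y =>
      if y != ord0 then C1 x (ord_pred y) else
      C2 (iter (twist2 v) (@ordS _) (lshift (width3 v) x)) ord_max
  | C2 x y =>
      if y != ord0 then C2 x (ord_pred y) else
      match split x with
      | inl t => C1 (iter (twist1 v) (@ordS _) t) ord_max
      | inr t => C3 (iter (twist3 v) (@ordS _) t) ord_max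
      end
  | C3 x y =>
      if y != ord0 then C3 x (ord_pred y) else
      C2 (iter (twist2 v) (@ordS _) (rshift (width1 v) x)) ord_max
  end.
apply: (@can_inj _ _ _ bottom) => -[[[x y]|[x y]]|[x y]] /=.
- case: eqVneq => [->|/ordS0 y0] /=; last by rewrite y0 ordSK.
  by rewrite (unsplitK (inl _)) fromK.
- case: eqVneq => [->|/ordS0 y0] /=; last by rewrite y0 ordSK.
  by case def_t: (split _) => [t|t] /=; congr (C2 _ _);
    rewrite -[RHS](fromK _ (twist2 v)) -[in RHS](splitK (from_abscissa _ x))
            def_t.
- case: eqVneq => [->|/ordS0 y0] /=; last by rewrite y0 ordSK.
  by rewrite (unsplitK (inr _)) fromK.
Qed.

Definition surface_of (v : params) : gluing :=
  Gluing (perm (@cyl_right_inj v)) (perm (@cyl_top_inj v)).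

Definition positive_sizes (v : params) : Prop :=
  [/\ 1 <= height1 v, 1 <= height2 v, 1 <= height3 v, 1 <= width1 v
    & 1 <= width3 v].

Definition has_diagram_D (S : gluing) : Prop :=
  exists2 v, positive_sizes v & isomorphic S (surface_of v).

Definition admissible (n : nat) (v : params) : Prop :=
  let: Params p q r k l alpha beta gamma := v in
  [/\ positive_sizes v, (p + q) * k + (r + q) * l = n,
      alpha < k, beta < k + l & gamma < l].

Definition Sigma1 (n : nat) (v : params) : Prop :=
  admissible n v /\ width1 v < width3 v.

Definition Sigma2 (n : nat) (v : params) : Prop :=
  admissible n v /\ (width1 v = width3 v /\ height1 v < height3 v).

Definition Sigma3 (n : nat) (v : params) : Prop :=
  admissible n v /\
  [/\ width1 v = width3 v, height1 v = height3 v & twist1 v <= twist3 v].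

Definition Sigma_D (n : nat) (v : params) : Prop :=
  [\/ Sigma1 n v, Sigma2 n v | Sigma3 n v].

(* Main.v *)
Require Import Defs.
From mathcomp Require Import all_boot perm.
From mathcomp Require Import zify.

(* Turning around a vertex: the vertex at the bottom left corner of a square s
   has angle 2 pi c, where c is the length of the cycle of s under the
   commutator of the two gluing permutations.  On the surface with parameters
   v, the commutator moves only the squares above the left ends of k1, l1, k2
   and l2, exchanging the first two and the last two: hence two cone points of
   angle 4 pi.

   Uniqueness: an isomorphism preserves the length of the orbits of
   [right_nbr], so it preserves the widest cylinder C2, and it either preserves
   or exchanges C1 and C3; the latter case reduces to the former by swapping
   (p, k, alpha) with (r, l, gamma).  If all three cylinders are preserved, then
   so are the squares above the left ends of the segments, which are
   characterized by the cylinders around them, and all parameters can be read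
   off from them.  Finally, Sigma_D contains exactly one tuple of each orbit of
   the swap. *)

Set Implicit Arguments.
Unset Strict Implicit.
Unset Printing Implicit Defensive.

(** * Vertices and the commutator *)

(* The corner that follows [c] counterclockwise around its vertex. *)
Definition turn (S : gluing) (c : corner S) : corner S :=
  let: (s, a, b) := c in
  match a, b with
  | false, false => ((right_nbr S)^-1%g s, true, false)
  | true, false => ((top_nbr S)^-1%g s, true, true)
  | true, true => (right_nbr S s, false, true)
  | false, true => (top_nbr S s, false, false)
  end.

Definition commutator (S : gluing) (s : S) : S :=
  top_nbr S (right_nbr S ((top_nbr S)^-1%g ((right_nbr S)^-1%g s))).

(** Every square has the form [right_nbr T (top_nbr T s)], so this evaluates the commutator without
    inverses, by comparing the two routes from [s] to its diagonal neighbour. *)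
Lemma commutator_right_top (T : gluing) (s : T) :
  commutator (right_nbr T (top_nbr T s)) = top_nbr T (right_nbr T s).
Proof. by rewrite /commutator !permK. Qed.

Lemma turn_inj S : injective (@turn S).
Proof.
by move=> [[s []] []] [[t []] []] //= [] /perm_inj ->.
Qed.

(** Two sides meet at a corner: [turn] crosses one, its inverse the other. Since [turn] is injective
    on a finite type, its orbits already form an equivalence relation. *)
Lemma same_vertexE S (c d : corner S) :
  same_vertex c d = fconnect (@turn S) c d.
Proof.
have gluedE (u v : corner S) :
    corner_glued u v || corner_glued v u = (turn u == v) || (turn v == u).
  have permV (p : {perm S}) (s t : S) : (p^-1%g s == t) = (s == p t).
    exact: (can2_eq (permKV p) (permK p)).
  by case: u v => [[s []] []] [[t []] []];
    rewrite /= !xpair_eqE /= ?andbF ?andbT ?permV ?orbF ?(eq_sym s) ?(eq_sym t).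
have Sf := fconnect_sym (@turn_inj S).
have sub1 : subrel (@same_vertex S) (fconnect (@turn S)).
  apply: connect_sub => u v /=; rewrite gluedE.
  by case/orP=> /eqP<-; rewrite ?fconnect1 // Sf fconnect1.
have sub2 : subrel (fconnect (@turn S)) (@same_vertex S).
  by apply: connect_sub => u v /= /eqP uv; rewrite connect1 // gluedE uv eqxx.
by apply/idP/idP; [apply: sub1 | apply: sub2].
Qed.

Lemma verticesE S :
  vertices S = [set [set d | fconnect (@turn S) c d] | c in [set: corner S]].
Proof.
apply: eq_imset => c; apply/setP=> d.
by rewrite !inE same_vertexE.
Qed.

(** The four kinds of corners follow each other cyclically under [turn], so at most three turns
    suffice. Vertices can thus be studied through squares. *)
Lemma fconnect_bottom_left S (c : corner S) :
  exists s : S, fconnect (@turn S) (s, false, false) c.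
Proof.
case: c => [[s a] b]; have Sf := fconnect_sym (@turn_inj S).
suff [j [t tj]] : exists j t, (t, false, false) = iter j (@turn S) (s, a, b).
  by exists t; rewrite Sf tj fconnect_iter.
case: a; case: b; last 1 first.
- by exists 0, s.
- by exists 2; eexists.
- by exists 3; eexists.
- by exists 1; eexists.
Qed.

(** Four turns lead from the bottom left corner of [s] to that of [commutator s]. *)
Lemma regular_vertex (S : gluing) (s : S) : commutator s = s ->
  angle [set d | fconnect (@turn S) (s, false, false) d] = 4.
Proof.
move=> ks; rewrite /angle cardsE.
apply: (@order_cycle _ _ (traject (@turn S) (s, false, false) 4)).
  by rewrite /commutator in ks; rewrite /= ks !eqxx.
by rewrite /= !inE !xpair_eqE /= !andbF.
exact: mem_head.
Qed.

(** The cycle closes after two rounds of four turns. Corners of the same kind in the two rounds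
    differ because [s != t] and the gluings are injective. *)
Lemma swapped_vertex (S : gluing) (s t : S) :
    s != t -> commutator s = t -> commutator t = s ->
  let c := (s, false, false) : corner S in
  (forall e, fconnect (@turn S) c e = (e \in traject (@turn S) c 8))
  /\ angle [set d | fconnect (@turn S) c d] = 8.
Proof.
move=> st ks kt c.
have cyc: fcycle (@turn S) (traject (@turn S) c 8).
  by rewrite /commutator in ks kt; rewrite /= ks kt !eqxx.
have c_in : c \in traject (@turn S) c 8 by exact: mem_head.
split; first exact: (fconnect_cycle cyc c_in).
rewrite /angle cardsE; apply: (order_cycle cyc) => //.
rewrite /commutator in ks kt; rewrite /= ks !inE !xpair_eqE /= !andbF !andbT /=.
by rewrite !(inj_eq (@perm_inj _ _)) (negPf st).
Qed.

Lemma in_H11_of_swaps (S : gluing) (a b c d : S) :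
    uniq [:: a; b; c; d] ->
    commutator a = b -> commutator b = a ->
    commutator c = d -> commutator d = c ->
    (forall s, s \notin [:: a; b; c; d] -> commutator s = s) ->
  in_H11 S.
Proof.
move=> abcd ka kb kc kd kfix.
pose BL (s : S) : corner S := (s, false, false).
pose V s := [set e | fconnect (@turn S) (BL s) e].
have [ab ac bc cd] : [/\ a != b, a != c, b != c & c != d].
  move: abcd; rewrite /= !inE !negb_or -!andbA.
  by case/and4P=> -> -> _ /and4P[-> _ ->].
have [Va anga] := swapped_vertex ab ka kb.
have [Vc angc] := swapped_vertex cd kc kd.
have VE s t : BL t \in V s -> V t = V s.
  rewrite inE => st; apply/setP=> e; rewrite !inE.
  by rewrite (same_connect (fconnect_sym (@turn_inj S)) st).
(* The bottom left corner of [b] is the fifth corner met when turning from that of [a]. *)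
have Vb : V b = V a.
  apply: VE; rewrite inE Va /= -[top_nbr S _]/(commutator a) ka.
  by rewrite !inE eqxx !orbT.
have Vd : V d = V c.
  apply: VE; rewrite inE Vc /= -[top_nbr S _]/(commutator c) kc.
  by rewrite !inE eqxx !orbT.
have cones : cone_points S = [set V a; V c].
  apply/setP=> W; rewrite !inE verticesE; apply/andP/orP.
    case=> /imsetP[e _ ->] ang; have [s se] := fconnect_bottom_left e.
    have {se} eV : [set d | fconnect (@turn S) e d] = V s.
      apply/setP=> e'; rewrite !inE.
      by rewrite (same_connect (fconnect_sym (@turn_inj S)) se).
    rewrite eV in ang *.
    have [|/kfix ks] := boolP (s \in [:: a; b; c; d]); last first.
      by rewrite regular_vertex in ang.
    by rewrite !inE => /or4P[] /eqP->; rewrite ?Vb ?Vd eqxx;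
      [left | left | right | right].
  by case=> /eqP->; rewrite ?anga ?angc; split=> //; apply: imset_f.
split.
  (* The only bottom left corners at the vertex of [a] are those of [a] and [b], so that of [c] lies
     elsewhere. *)
  rewrite cones cards2; have [VaVc|//] := eqVneq.
  have : BL c \in V a by rewrite VaVc inE connect0.
  rewrite inE Va /= -[top_nbr S _]/(commutator a) ka !inE !xpair_eqE !andbF /=.
  by rewrite !andbT orbF ![c == _]eq_sym (negPf ac) (negPf bc).
by move=> W; rewrite cones !inE => /orP[] /eqP->.
Qed.

(** * Cyclic shifts of abscissas *)

Lemma val_iter_ordS w a (x : 'I_w) : iter a (@ordS w) x = (x + a) %% w :> nat.
Proof.
elim: a => [|a IHa]; first by rewrite addn0 modn_small.
by rewrite iterS /= IHa -addn1 modnDml addn1 addnS.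
Qed.

Lemma iter_ordSK w a : cancel (iter a (@ordS w)) (@from_abscissa w a).
Proof.
elim: a => // a IHa x.
by rewrite iterSr /from_abscissa iterS -/(from_abscissa _ _) IHa ordSK.
Qed.

Lemma from_abscissaK w a : cancel (@from_abscissa w a) (iter a (@ordS w)).
Proof.
elim: a => // a IHa x; rewrite iterSr /from_abscissa iterS ord_predK.
exact: IHa.
Qed.

Lemma ordS_max w : ordS (@ord_max w) = ord0.
Proof. by apply: val_inj; rewrite /= modnn. Qed.

Lemma val_ordS w (x : 'I_w.+1) : x != ord_max -> ordS x = x.+1 :> nat.
Proof.
move=> x_max; rewrite /= modn_small // ltnS ltn_neqAle.
by rewrite -[x <= w]ltnS ltn_ord andbT.
Qed.

Lemma ordS_lshift k l (x : 'I_k.+1) :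
  ordS (lshift l.+1 x) =
    if x == ord_max then rshift k.+1 ord0 else lshift l.+1 (ordS x).
Proof.
apply: val_inj; case: eqVneq => [->|/val_ordS/= x_max] /=.
  by rewrite addn0 modn_small // addnS ltnS leq_addr.
rewrite x_max modn_small //; apply: leq_trans (leq_addr _ _).
by rewrite -x_max ltn_pmod.
Qed.

Lemma ordS_rshift k l (x : 'I_l.+1) :
  ordS (rshift k.+1 x) =
    if x == ord_max then lshift l.+1 ord0 else rshift k.+1 (ordS x).
Proof.
apply: val_inj; case: eqVneq => [->|/val_ordS/= x_max] /=.
  by rewrite -addnS modnn.
by rewrite x_max -addnS modn_small // ltn_add2l -x_max ltn_pmod.
Qed.

(** Climb the first column, then go right along a row. The upward step stays inside the cylinder:
    above the top row, the gluing decides. *)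
Lemma grid_ind w h (P : 'I_w.+1 -> 'I_h.+1 -> Prop) :
    P ord0 ord0 ->
    (forall x y, P x y -> P (ordS x) y) ->
    (forall x y, y != ord_max -> P x y -> P x (ordS y)) ->
  forall x y, P x y.
Proof.
move=> P00 Pr Pt x y.
have P0 j : j <= h -> P ord0 (inord j).
  elim: j => [|j IHj] lt_j.
    by congr (P _ _): P00; apply: ord_inj; rewrite inordK.
  have j_max : inord j != ord_max :> 'I_h.+1.
    by rewrite -val_eqE /= inordK ?ltn_eqF // ltnW.
  have := Pt _ _ j_max (IHj (ltnW lt_j)); congr (P _ _); apply: ord_inj.
  by rewrite val_ordS // !inordK // ltnW.
have {}P0 : P ord0 y by rewrite -[y]inord_val; apply: P0; rewrite -ltnS.
have <- : iter x (@ordS _) ord0 = x.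
  by apply: ord_inj; rewrite val_iter_ordS add0n modn_small.
by elim: (x : nat) => //= j; apply: Pr.
Qed.

(** * The surface of a tuple of parameters *)

Lemma rightE v (s : cylinders v) : right_nbr (surface_of v) s = cyl_right s.
Proof. exact: permE. Qed.

Lemma topE v (s : cylinders v) : top_nbr (surface_of v) s = cyl_top s.
Proof. exact: permE. Qed.

Definition cyl_index v (s : cylinders v) : nat :=
  match s with C1 _ _ => 1 | C2 _ _ => 2 | C3 _ _ => 3 end.

Section Surface.
Variables p q r k l alpha beta gamma : nat.
(** Circumferences are successors, so that each cylinder has a first and a last column. *)
Let v := Params p q r k.+1 l.+1 alpha beta gamma.
Let S := surface_of v.
Implicit Types s t u : cylinders v.

Lemma top_C1 x :
  cyl_top (C1 (iter alpha (@ordS _) x) ord_max : cylinders v)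
  = C2 (lshift l.+1 x) ord0.
Proof. by rewrite /= eqxx iter_ordSK. Qed.

Lemma top_C3 x :
  cyl_top (C3 (iter gamma (@ordS _) x) ord_max : cylinders v)
  = C2 (rshift k.+1 x) ord0.
Proof. by rewrite /= eqxx iter_ordSK. Qed.

Lemma top_C2_left x :
  cyl_top (C2 (iter beta (@ordS _) (lshift l.+1 x)) ord_max : cylinders v)
  = C1 x ord0.
Proof. by rewrite /= eqxx iter_ordSK (unsplitK (inl _)). Qed.

Lemma top_C2_right x :
  cyl_top (C2 (iter beta (@ordS _) (rshift k.+1 x)) ord_max : cylinders v)
  = C3 x ord0.
Proof. by rewrite /= eqxx iter_ordSK (unsplitK (inr _)). Qed.

Lemma right_C1 a x y :
  cyl_right (C1 (iter a (@ordS _) x) y : cylinders v)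
  = C1 (iter a (@ordS _) (ordS x)) y.
Proof. by rewrite -iterSr. Qed.

Lemma right_C2 a x y :
  cyl_right (C2 (iter a (@ordS _) x) y : cylinders v)
  = C2 (iter a (@ordS _) (ordS x)) y.
Proof. by rewrite -iterSr. Qed.

Lemma right_C3 a x y :
  cyl_right (C3 (iter a (@ordS _) x) y : cylinders v)
  = C3 (iter a (@ordS _) (ordS x)) y.
Proof. by rewrite -iterSr. Qed.

(* The squares of a top row are addressed by the position [x] in the segment
   that they meet, rather than by their column. *)
Variant cell_spec : cylinders v -> Prop :=
| InnerC1 x y of y != ord_max : cell_spec (C1 x y)
| InnerC2 x y of y != ord_max : cell_spec (C2 x y)
| InnerC3 x y of y != ord_max : cell_spec (C3 x y)
| TopC1 x : cell_spec (C1 (iter alpha (@ordS _) x) ord_max)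
| TopC2_left x : cell_spec (C2 (iter beta (@ordS _) (lshift l.+1 x)) ord_max)
| TopC2_right x : cell_spec (C2 (iter beta (@ordS _) (rshift k.+1 x)) ord_max)
| TopC3 x : cell_spec (C3 (iter gamma (@ordS _) x) ord_max).

Lemma cellP s : cell_spec s.
Proof.
case: s => [[[x y]|[x y]]|[x y]]; have [->|y_max] := eqVneq y ord_max;
  try by constructor.
- by rewrite -[x](@from_abscissaK _ alpha); constructor.
- rewrite -[x](@from_abscissaK _ beta).
  by case: (split_ordP (from_abscissa beta x)) => j ->; constructor.
- by rewrite -[x](@from_abscissaK _ gamma); constructor.
Qed.

Lemma surface_in_H11 : in_H11 S.
Proof.
pose d1 : S := C1 ord0 ord0; pose d2 : S := C2 (lshift l.+1 ord0) ord0.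
pose d3 : S := C2 (rshift k.+1 ord0) ord0; pose d4 : S := C3 ord0 ord0.
have kE (s : S) :
  commutator (cyl_right (cyl_top s) : S) = cyl_top (cyl_right s).
  by rewrite -rightE -topE commutator_right_top rightE topE.
(* Each of the four values comes from the square below the last column of a segment: one of the two
   routes to its diagonal neighbour wraps around to the start of that segment, the other enters the
   next segment. *)
have k4 : commutator d4 = d1.
  have := kE (C2 (iter beta (@ordS _) (rshift k.+1 ord_max)) ord_max).
  by rewrite top_C2_right right_C2 ordS_rshift eqxx top_C2_left /= ordS_max.
have k1 : commutator d1 = d4.
  have := kE (C2 (iter beta (@ordS _) (lshift l.+1 ord_max)) ord_max).
  by rewrite top_C2_left right_C2 ordS_lshift eqxx top_C2_right /= ordS_max.
have k2 : commutator d2 = d3.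
  have := kE (C3 (iter gamma (@ordS _) ord_max) ord_max).
  by rewrite top_C3 right_C3 ordS_max top_C3 /= ordS_rshift eqxx.
have k3 : commutator d3 = d2.
  have := kE (C1 (iter alpha (@ordS _) ord_max) ord_max).
  by rewrite top_C1 right_C1 ordS_max top_C1 /= ordS_lshift eqxx.
apply: (in_H11_of_swaps (a := d1) (b := d4) (c := d2) (d := d3)) => // s.
pose u := ((top_nbr S)^-1%g ((right_nbr S)^-1%g s)).
have -> : s = cyl_right (cyl_top u) by rewrite -rightE -topE !permKV.
rewrite kE.
(* The two routes from [u] agree unless [u] lies below the last column of a segment, and then [s] is
   one of the four listed squares. *)
case: (cellP u) => [x y y_max|x y y_max|x y y_max|x|x|x|x].
- by rewrite /= y_max.
- by rewrite /= y_max.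
- by rewrite /= y_max.
- rewrite right_C1 !top_C1 /= ordS_lshift; case: eqVneq => //.
  by rewrite !inE eqxx !orbT.
- rewrite right_C2 ordS_lshift top_C2_left.
  case: eqVneq => [->|_]; last by rewrite top_C2_left.
  by rewrite /= ordS_max !inE eqxx.
- rewrite right_C2 ordS_rshift top_C2_right.
  case: eqVneq => [->|_]; last by rewrite top_C2_right.
  by rewrite /= ordS_max !inE eqxx orbT.
- by rewrite right_C3 !top_C3 /= ordS_rshift; case: eqVneq.
Qed.

(* The left end of k2 is where C1 below meets C3 below to the left. *)
Lemma start_k2 t u : cyl_index u = 3 -> cyl_index t = 1 ->
  cyl_right (cyl_top u) = cyl_top t -> cyl_top t = C2 (lshift l.+1 ord0) ord0.
Proof.
case: (cellP t) => // [x y y_max|x];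
  case: (cellP u) => // [x' y' y'_max|x'] _ _.
- by rewrite /= y_max y'_max.
- by rewrite top_C3 /= y_max.
- by rewrite top_C1 /= y'_max.
rewrite top_C1 top_C3 /= ordS_rshift; case: eqP => _; first by move=> ->.
(* Unless [u] lies below the last column of l2, the square to the right of [cyl_top u] is still
   above l2, whereas [cyl_top t] is above k2. *)
by case=> E; have := ltn_ord x; rewrite -E /=; lia.
Qed.

(** Along the top of C2, the left end of k1 is the only place where C3 above gives way to C1
    above. *)
Lemma start_k1 u : cyl_index u = 2 -> cyl_index (cyl_top u) = 3 ->
  cyl_index (cyl_top (cyl_right u)) = 1 ->
  cyl_top (cyl_right u) = C1 ord0 ord0.
Proof.
case: (cellP u) => // [x y y_max|x|x] _.
- by rewrite /= y_max.
- by rewrite top_C2_left.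
rewrite right_C2 ordS_rshift; case: ifP => _; first by rewrite top_C2_left.
by rewrite !top_C2_right.
Qed.

(** Fill C2 first; its top row leads to the left ends of k1 and l1, from which C1 and C3 are
    filled. *)
Lemma cylinders_ind (P : cylinders v -> Prop) :
    P (C2 (lshift l.+1 ord0) ord0) ->
    (forall s, P s -> P (cyl_right s)) -> (forall s, P s -> P (cyl_top s)) ->
  forall s, P s.
Proof.
move=> P0 Pr Pt.
have P2 x y : P (C2 x y).
  move: x y; apply: (@grid_ind (k + l.+1) q.-1 (fun x y => P (C2 x y))).
  - by congr (P (C2 _ _)): P0; apply: ord_inj.
  - by move=> x y /Pr.
  - by move=> x y y_max /Pt; rewrite /= y_max.
case=> [[[x y]|[x y]]|[x y]]; last 2 first.
- exact: P2.
- move: x y; apply: (@grid_ind l r.-1 (fun x y => P (C3 x y))).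
  - by rewrite -top_C2_right; apply/Pt/P2.
  - by move=> x y /Pr.
  - by move=> x y y_max /Pt; rewrite /= y_max.
move: x y; apply: (@grid_ind k p.-1 (fun x y => P (C1 x y))).
- by rewrite -top_C2_left; apply/Pt/P2.
- by move=> x y /Pr.
- by move=> x y y_max /Pt; rewrite /= y_max.
Qed.

Lemma surface_connected (s t : S) : connect (@adjacent S) s t.
Proof.
have adjC : symmetric (@adjacent S).
  by move=> x y; rewrite /adjacent; do !case: (_ == _).
have from0 : forall u : cylinders v,
    connect (@adjacent S) (C2 (lshift l.+1 ord0) ord0) u.
  elim/cylinders_ind => // u cu; apply: connect_trans cu (connect1 _).
    by rewrite /adjacent rightE eqxx.
  by rewrite /adjacent topE eqxx !orbT.
by apply: connect_trans (from0 t); rewrite (sym_connect_sym adjC) from0.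
Qed.

(** Positivity matters because [cylinder] gives a cylinder of height 0 one row. *)
Lemma card_cylinders : 0 < p -> 0 < q -> 0 < r ->
  #|cylinders v| = (p + q) * k.+1 + (r + q) * l.+1.
Proof.
move=> p_gt0 q_gt0 r_gt0.
rewrite !card_sum !card_prod !card_ord !prednK //=.
lia.
Qed.
End Surface.

(** * Isomorphisms and circumferences *)

Definition cylinder_iso (v w : params) (f : cylinders v -> cylinders w) :=
  [/\ bijective f, forall s, f (cyl_right s) = cyl_right (f s)
    & forall s, f (cyl_top s) = cyl_top (f s)].

Lemma isomorphicP v w :
  isomorphic (surface_of v) (surface_of w)
  <-> exists f : cylinders v -> cylinders w, cylinder_iso f.
Proof.
split=> -[f [bf fr ft]]; exists f; split=> // s.
- by have := fr s; rewrite !rightE.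
- by have := ft s; rewrite !topE.
- by rewrite !rightE.
- by rewrite !topE.
Qed.

Lemma isomorphic_sym S T : isomorphic S T -> isomorphic T S.
Proof.
case=> f [[g fK gK] fr ft]; exists g; split=> [|s|s].
- by exists f.
- by apply: (can_inj fK); rewrite fr !gK.
- by apply: (can_inj fK); rewrite ft !gK.
Qed.

Lemma isomorphic_trans S T U :
  isomorphic S T -> isomorphic T U -> isomorphic S U.
Proof.
case=> f [bf fr ft] [g [bg gr gt]]; exists (g \o f).
by split=> [|s|s] /=; [exact: bij_comp | rewrite fr gr | rewrite ft gt].
Qed.

Definition cyl_width v (s : cylinders v) : nat :=
  match s with
  | C1 _ _ => width1 v | C2 _ _ => width1 v + width3 v | C3 _ _ => width3 v
  end.

Lemma index_right v (s : cylinders v) : cyl_index (cyl_right s) = cyl_index s.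
Proof. by case: s => [[[x y]|[x y]]|[x y]]. Qed.

Lemma iter_ordS_eq w j (x : 'I_w) : (iter j (@ordS w) x == x) = (w %| j).
Proof.
rewrite -val_eqE /= val_iter_ordS -{2}[x : nat]addn0.
rewrite -[X in _ == X](modn_small (_ : x + 0 < w)); last by rewrite addn0.
by rewrite eqn_modDl mod0n.
Qed.

(** This makes [cyl_width s] the length of the orbit of [s] under [cyl_right]. *)
Lemma iter_right_eq v (s : cylinders v) j :
  (iter j (@cyl_right v) s == s) = (cyl_width s %| j).
Proof.
have -> : iter j (@cyl_right v) s =
  match s with
  | C1 x y => C1 (iter j (@ordS _) x) y
  | C2 x y => C2 (iter j (@ordS _) x) y
  | C3 x y => C3 (iter j (@ordS _) x) y
  end.
  by case: s => [[[x y]|[x y]]|[x y]]; elim: j => //= j ->.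
by case: s => [[[x y]|[x y]]|[x y]]; rewrite /= -(@iter_ordS_eq _ j x);
  apply/eqP/eqP=> [[]|->].
Qed.

Lemma iso_width v w (f : cylinders v -> cylinders w) :
  cylinder_iso f -> forall s, cyl_width (f s) = cyl_width s.
Proof.
case=> /bij_inj f_inj fr _ s.
have E j : (cyl_width (f s) %| j) = (cyl_width s %| j).
  rewrite -!iter_right_eq -(inj_eq f_inj); congr (_ == _).
  by elim: j => //= j ->; rewrite fr.
(* Two numbers with the same multiples are equal. *)
by apply/eqP; rewrite eqn_dvd E dvdnn -E dvdnn.
Qed.

(** * Exchanging C1 and C3 *)

Definition swap (v : params) : params :=
  let: Params p q r k l alpha beta gamma := v in
  Params r q p l k gamma beta alpha.

(* The abscissa of C2 is shifted by k, so that l2 now starts at 0; then l1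
   starts at beta, which is why [twist2] is left unchanged. *)
Definition swap_square (v : params) : cylinders v -> cylinders (swap v) :=
  let: Params p q r k l alpha beta gamma := v in
  fun s : cylinders (Params p q r k l alpha beta gamma) =>
  match s return cylinders (Params r q p l k gamma beta alpha) with
  | C1 x y => C3 x y
  | C2 x y =>
      C2 (match split x with inl t => rshift l t | inr t => lshift k t end) y
  | C3 x y => C1 x y
  end.

Lemma swap_iso (p q r k l alpha beta gamma : nat) :
  let v := Params p q r k.+1 l.+1 alpha beta gamma in
  cylinder_iso (@swap_square v).
Proof.
move=> v.
(* Exchanging two adjacent blocks of columns is the rotation by [n] of a cycle of length [m + n], so
   it commutes with [ordS] and with every twist. *)
pose rot m n (x : 'I_(m + n)) : 'I_(n + m) :=
  match split x with inl t => rshift n t | inr t => lshift m t end.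
have rotl m n (x : 'I_m) : rot m n (lshift n x) = rshift n x.
  by rewrite /rot (unsplitK (inl _)).
have rotr m n (x : 'I_n) : rot m n (rshift m x) = lshift m x.
  by rewrite /rot (unsplitK (inr _)).
have rotS m n x : rot m.+1 n.+1 (ordS x) = ordS (rot m.+1 n.+1 x).
  case: (split_ordP x) => j ->.
    rewrite rotl ordS_lshift ordS_rshift.
    by case: ifP => _; rewrite ?rotl ?rotr.
  rewrite rotr ordS_lshift ordS_rshift.
  by case: ifP => _; rewrite ?rotl ?rotr.
have rot_iter m n a x :
    rot m.+1 n.+1 (iter a (@ordS _) x) = iter a (@ordS _) (rot m.+1 n.+1 x).
  by elim: a => //= a <-; rewrite rotS.
have rotK m n : cancel (rot m n) (rot n m).
  by move=> x; case: (split_ordP x) => j ->; rewrite ?rotl ?rotr ?rotl.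
split.
- exists (@swap_square (swap v) : cylinders (swap v) -> cylinders v).
    by case=> [[[x y]|[x y]]|[x y]] //=; congr (C2 _ _); apply: rotK.
  by case=> [[[x y]|[x y]]|[x y]] //=; congr (C2 _ _); apply: rotK.
- by case=> [[[x y]|[x y]]|[x y]] //=; congr (C2 _ _); apply: rotS.
move=> s; case: (cellP s) => [x y y_max|x y y_max|x y y_max|x|x|x|x].
- by rewrite /= !y_max.
- by rewrite /= !y_max.
- by rewrite /= !y_max.
- rewrite top_C1 [RHS]top_C3 /=; congr (C2 _ _); exact: rotl.
- rewrite top_C2_left /= -!/(rot _ _ _) rot_iter rotl.
  exact: esym (top_C2_right _).
- rewrite top_C2_right /= -!/(rot _ _ _) rot_iter rotr.
  exact: esym (top_C2_left _).
- rewrite top_C3 [RHS]top_C1 /=; congr (C2 _ _); exact: rotr.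
Qed.

(** * Action of an isomorphism on cylinders and their coordinates *)

Lemma cylinder_iso_inv v w (f : cylinders v -> cylinders w) : cylinder_iso f ->
  exists2 g, cylinder_iso g & cancel f g /\ cancel g f.
Proof.
case=> -[g fK gK] fr ft; exists g => //; split=> [|s|s].
- by exists f.
- by apply: (can_inj fK); rewrite fr !gK.
- by apply: (can_inj fK); rewrite ft !gK.
Qed.

Lemma cyl_width_le v (s : cylinders v) : cyl_width s <= width1 v + width3 v.
Proof. by case: s => [[[x y]|[x y]]|[x y]]; rewrite ?leq_addr ?leq_addl. Qed.

Lemma index2E v (s : cylinders v) : 0 < width1 v -> 0 < width3 v ->
  (cyl_index s == 2) = (cyl_width s == width1 v + width3 v).
Proof. by case: s => [[[x y]|[x y]]|[x y]] /=; lia. Qed.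

Lemma iso_sum_widths p q r k l alpha beta gamma
    p' q' r' k' l' alpha' beta' gamma' :
  let v := Params p q r k.+1 l.+1 alpha beta gamma in
  let w := Params p' q' r' k'.+1 l'.+1 alpha' beta' gamma' in
  forall f : cylinders v -> cylinders w, cylinder_iso f ->
  k + l = k' + l' /\ forall s, (cyl_index (f s) == 2) = (cyl_index s == 2).
Proof.
move=> v w f f_iso; have [g g_iso _] := cylinder_iso_inv f_iso.
have kl: k + l = k' + l'.
  (* No square is wider than C2, so [f] and its inverse give the two inequalities. *)
  have := cyl_width_le (f (C2 (lshift l.+1 ord0) ord0)).
  have := cyl_width_le (g (C2 (lshift l'.+1 ord0) ord0)).
  rewrite (iso_width f_iso) (iso_width g_iso) /=; lia.
by split=> // s; rewrite !index2E //= (iso_width f_iso); lia.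
Qed.

(** C1 and C3 share no segment: going up, both lead into C2. *)
Lemma index_top v (s : cylinders v) :
  cyl_index s != 2 -> cyl_index (cyl_top s) != 2 ->
  cyl_index (cyl_top s) = cyl_index s.
Proof.
by case: s => [[[x y]|[x y]]|[x y]] //=; case: ifP.
Qed.

(** Here [c] and [c'] are coordinates on corresponding cylinders. Once the origins match, [f]
    preserves coordinates. Rows are compared as numbers, since [h = h'] is part of the
    conclusion. *)
Lemma grid_rigid v w (f : cylinders v -> cylinders w) m h h'
    (c : 'I_m.+1 -> 'I_h.+1 -> cylinders v)
    (c' : 'I_m.+1 -> 'I_h'.+1 -> cylinders w) :
    cylinder_iso f -> (forall s, cyl_index (f s) = cyl_index s) ->
    (forall x y, cyl_right (c x y) = c (ordS x) y) ->
    (forall x y, cyl_right (c' x y) = c' (ordS x) y) ->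
    (forall x y, y != ord_max -> cyl_top (c x y) = c x (ordS y)) ->
    (forall x y, y != ord_max -> cyl_top (c' x y) = c' x (ordS y)) ->
    (forall x y,
      (cyl_index (cyl_top (c x y)) == cyl_index (c x y)) = (y != ord_max)) ->
    (forall x y,
      (cyl_index (cyl_top (c' x y)) == cyl_index (c' x y)) = (y != ord_max)) ->
    f (c ord0 ord0) = c' ord0 ord0 ->
  h = h' /\ forall x (y : 'I_h.+1) (y' : 'I_h'.+1),
    y = y' :> nat -> f (c x y) = c' x y'.
Proof.
case=> bf fr ft fi cr cr' ct ct' ci ci' f0.
(* Top rows correspond: they are where going up changes the index, and [f] preserves indices. *)
have fmax x y y' : f (c x y) = c' x y' -> (y != ord_max) = (y' != ord_max).
  by move=> fc; rewrite -(ci' x) -fc -ft !fi ci.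
have H x y : exists2 y' : 'I_h'.+1, f (c x y) = c' x y' & y = y' :> nat.
  move: x y; apply: grid_ind => [|x y [y' fc yy']|x y y_max [y' fc yy']].
  - by exists ord0.
  - by exists y'; rewrite // -cr fr fc cr'.
  have y'_max : y' != ord_max by rewrite -(fmax _ _ _ fc).
  exists (ordS y'); first by rewrite -ct // ft fc ct'.
  by rewrite !val_ordS // yy'.
split.
  have [y' /fmax] := H ord0 ord_max; rewrite eqxx => /esym/negbFE/eqP->.
  by [].
move=> x y y' yy'; have [y'' -> yy''] := H x y; congr (c' _ _).
by apply: ord_inj; rewrite -yy' -yy''.
Qed.

Lemma iter_ordS_small_inj w a b (x : 'I_w) : a < w -> b < w ->
  iter a (@ordS w) x = iter b (@ordS w) x -> a = b.
Proof.
move=> aw bw /(congr1 (@nat_of_ord w)); rewrite !val_iter_ordS => /eqP.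
by rewrite eqn_modDl !modn_small // => /eqP.
Qed.

(** The left end of k2 is the origin of C2, so [f] preserves the coordinates of C2. The left end of
    k1 then yields [beta], and with it the left end of l1. These are the origins of C1 and C3, whose
    top rows finally yield [alpha] and [gamma]. *)
Lemma iso_same_index p q r k l alpha beta gamma p' q' r' alpha' beta' gamma' :
  let v := Params p.+1 q.+1 r.+1 k.+1 l.+1 alpha beta gamma in
  let w := Params p'.+1 q'.+1 r'.+1 k.+1 l.+1 alpha' beta' gamma' in
  alpha < k.+1 -> beta < k.+1 + l.+1 -> gamma < l.+1 ->
  alpha' < k.+1 -> beta' < k.+1 + l.+1 -> gamma' < l.+1 ->
  forall f : cylinders v -> cylinders w, cylinder_iso f ->
  (forall s, cyl_index (f s) = cyl_index s) -> v = w.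
Proof.
move=> v w a_lt b_lt g_lt a'_lt b'_lt g'_lt f f_iso fi.
have [bf fr ft] := f_iso.
have top_inj : injective (@cyl_top w) := @cyl_top_inj w.
(* These are the squares below the left end of k2 and below the right end of l2. *)
pose t : cylinders v := C1 (iter alpha (@ordS _) ord0) ord_max.
pose u : cylinders v := C3 (iter gamma (@ordS _) ord_max) ord_max.
have tE : cyl_top t = C2 (lshift l.+1 ord0) ord0 by exact: top_C1.
have f2_0 : f (C2 (lshift l.+1 ord0) ord0) = C2 (lshift l.+1 ord0) ord0.
  rewrite -tE ft; apply: (start_k2 (u := f u)); rewrite ?fi //.
  by rewrite -!ft -fr [cyl_top u]top_C3 tE /= ordS_rshift eqxx.
have top2 (y0 : params) x (y : 'I_(height2 y0).-1.+1) :
    (cyl_index (cyl_top (C2 x y : cylinders y0)) == 2) = (y != ord_max).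
  by rewrite /=; case: ifP => // _; case: split.
have top1 (y0 : params) x (y : 'I_(height1 y0).-1.+1) :
    (cyl_index (cyl_top (C1 x y : cylinders y0)) == 1) = (y != ord_max).
  by rewrite /=; case: ifP.
have top3 (y0 : params) x (y : 'I_(height3 y0).-1.+1) :
    (cyl_index (cyl_top (C3 x y : cylinders y0)) == 3) = (y != ord_max).
  by rewrite /=; case: ifP.
have [qq' f2] : q = q' /\ forall x (y : 'I_q.+1) (y' : 'I_q'.+1),
    y = y' :> nat -> f (C2 x y) = C2 x y'.
  apply: (@grid_rigid v w f (k + l.+1) q q'
    (fun x y => C2 x y) (fun x y => C2 x y)) => //.
  - by move=> x y y_max; rewrite /= y_max.
  - by move=> x y y_max; rewrite /= y_max.
  have e0 : ord0 = lshift l.+1 (ord0 : 'I_k.+1) :> 'I_(k.+1 + l.+1).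
    exact: ord_inj.
  by rewrite e0.
have f2max x : f (C2 x ord_max) = C2 x ord_max by apply: f2; rewrite /= qq'.
have f1_0 : f (C1 ord0 ord0) = C1 ord0 ord0.
  rewrite -(@top_C2_left p.+1 q.+1 r.+1 k l alpha beta gamma) ft.
  pose s : cylinders v :=
    C2 (iter beta (@ordS _) (rshift k.+1 ord_max)) ord_max.
  have sE : cyl_right s = C2 (iter beta (@ordS _) (lshift l.+1 ord0)) ord_max.
    by rewrite right_C2 ordS_rshift eqxx.
  rewrite -sE fr; apply: start_k1; rewrite -?fr -?ft fi //.
    by rewrite top_C2_right.
  by rewrite sE top_C2_left.
have bb' : beta = beta'.
  apply: (iter_ordS_small_inj b_lt b'_lt (x := lshift l.+1 ord0)).
  suff [] : C2 (iter beta (@ordS _) (lshift l.+1 ord0)) ord_max =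
         C2 (iter beta' (@ordS _) (lshift l.+1 ord0)) ord_max :> cylinders w.
    exact.
  by apply: top_inj; rewrite -f2max -ft !top_C2_left f1_0.
(* As the twists of C2 agree, the square below the left end of l1 has the same column in both
   surfaces. *)
have f3_0 : f (C3 ord0 ord0) = C3 ord0 ord0.
  rewrite -(@top_C2_right p.+1 q.+1 r.+1 k l alpha beta gamma).
  by rewrite ft f2max bb' top_C2_right.
have [pp' f1] : p = p' /\ forall x (y : 'I_p.+1) (y' : 'I_p'.+1),
    y = y' :> nat -> f (C1 x y) = C1 x y'.
  apply: (@grid_rigid v w f k p p'
    (fun x y => C1 x y) (fun x y => C1 x y)) => //.
  - by move=> x y y_max; rewrite /= y_max.
  - by move=> x y y_max; rewrite /= y_max.
have [rr' f3] : r = r' /\ forall x (y : 'I_r.+1) (y' : 'I_r'.+1),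
    y = y' :> nat -> f (C3 x y) = C3 x y'.
  apply: (@grid_rigid v w f l r r'
    (fun x y => C3 x y) (fun x y => C3 x y)) => //.
  - by move=> x y y_max; rewrite /= y_max.
  - by move=> x y y_max; rewrite /= y_max.
have f1max x : f (C1 x ord_max) = C1 x ord_max by apply: f1; rewrite /= pp'.
have f3max x : f (C3 x ord_max) = C3 x ord_max by apply: f3; rewrite /= rr'.
have aa' : alpha = alpha'.
  apply: (iter_ordS_small_inj a_lt a'_lt (x := ord0)).
  suff [] : C1 (iter alpha (@ordS _) ord0) ord_max =
         C1 (iter alpha' (@ordS _) ord0) ord_max :> cylinders w.
    exact.
  by apply: top_inj; rewrite -f1max -ft !top_C1 f2_0.
have gg' : gamma = gamma'.
  apply: (iter_ordS_small_inj g_lt g'_lt (x := ord0)).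
  suff [] : C3 (iter gamma (@ordS _) ord0) ord_max =
         C3 (iter gamma' (@ordS _) ord0) ord_max :> cylinders w.
    exact.
  by apply: top_inj; rewrite -f3max -ft !top_C3; apply: f2.
by rewrite /v /w pp' qq' rr' aa' bb' gg'.
Qed.

Lemma iso_index p q r k l alpha beta gamma p' q' r' k' l' alpha' beta' gamma' :
  let v := Params p q r k.+1 l.+1 alpha beta gamma in
  let w := Params p' q' r' k'.+1 l'.+1 alpha' beta' gamma' in
  forall f : cylinders v -> cylinders w, cylinder_iso f ->
  cyl_index (f (C1 ord0 ord0)) = 1 ->
  forall s, cyl_index (f s) = cyl_index s.
Proof.
move=> v w f f_iso f1_0; have [_ fr ft] := f_iso.
have [_ f2] := iso_sum_widths f_iso.
have f_top s : cyl_index s != 2 -> cyl_index (cyl_top s) != 2 ->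
    cyl_index (f (cyl_top s)) = cyl_index (f s).
  by move=> s2 ts2; rewrite ft index_top // -?ft f2.
have f1 x y : cyl_index (f (C1 x y)) = 1.
  move: x y; apply: (@grid_ind k p.-1 (fun x y => cyl_index (f (C1 x y)) = 1)).
  - exact: f1_0.
  - by move=> x y <-; rewrite -[RHS]index_right -fr.
  - by move=> x y y_max <-; have := f_top (C1 x y); rewrite /= y_max; apply.
have f3 x y : cyl_index (f (C3 x y)) = cyl_index (f (C3 ord0 ord0)).
  move: x y; apply: (@grid_ind l r.-1
    (fun x y => cyl_index (f (C3 x y)) = cyl_index (f (C3 ord0 ord0)))).
  - by [].
  - by move=> x y <-; rewrite -[RHS]index_right -fr.
  - by move=> x y y_max <-; have := f_top (C3 x y); rewrite /= y_max; apply.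
have f3_0 : cyl_index (f (C3 ord0 ord0)) = 3.
  (* By surjectivity some square is sent to the origin of C3; it lies neither in C1 nor in C2, and
     all squares of C3 have images of the same index. *)
  have [g _ [_ gK]] := cylinder_iso_inv f_iso.
  have := gK (C3 ord0 ord0); case: (g _) => [[[x y]|[x y]]|[x y]] fs.
  - by have := f1 x y; rewrite fs.
  - by have := f2 (C2 x y); rewrite fs.
  - by rewrite -(f3 x y) fs.
case=> [[[x y]|[x y]]|[x y]]; first exact: f1.
  by apply/eqP; rewrite f2.
by rewrite f3.
Qed.

Lemma cylinder_iso_comp u v w (f : cylinders u -> cylinders v)
    (g : cylinders v -> cylinders w) :
  cylinder_iso f -> cylinder_iso g -> cylinder_iso (g \o f).
Proof.
case=> bf fr ft [bg gr gt].
by split=> [|s|s] /=; [exact: bij_comp | rewrite fr gr | rewrite ft gt].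
Qed.

Lemma isomorphic_params m n v w : admissible m v -> admissible n w ->
  isomorphic (surface_of v) (surface_of w) -> v = w \/ v = swap w.
Proof.
case: v w => [[|p] [|q] [|r] [|k] [|l] a b c]
  [[|p'] [|q'] [|r'] [|k'] [|l'] a' b' c'] //;
  try by [case; case | move=> _ [[]]].
case=> _ _ aP bP cP [_ _ aP' bP' cP'] /isomorphicP[f f_iso].
(* The target is left general, to apply this both to [w] and to [swap w]. *)
have direct p1 q1 r1 k1 l1 a1 b1 c1 :
    let v := Params p.+1 q.+1 r.+1 k.+1 l.+1 a b c in
    let w := Params p1.+1 q1.+1 r1.+1 k1.+1 l1.+1 a1 b1 c1 in
    a1 < k1.+1 -> b1 < k1.+1 + l1.+1 -> c1 < l1.+1 ->
    forall g : cylinders v -> cylinders w, cylinder_iso g ->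
    cyl_index (g (C1 ord0 ord0)) = 1 -> v = w.
  move=> v w a1P b1P c1P g g_iso /(iso_index g_iso) gi.
  have kk : k = k1.
    have := iso_width g_iso (C1 ord0 ord0).
    by move: (gi (C1 ord0 ord0)); case: (g _) => [[[x y]|[x y]]|[x y]] //= _ [].
  have ll : l = l1.
    by have [E _] := iso_sum_widths g_iso; move: E; rewrite kk => /addnI.
  rewrite /v /w in g g_iso gi *; subst k1 l1.
  exact: (iso_same_index _ _ _ _ _ _ g_iso gi).
have [_ f2] := iso_sum_widths f_iso.
have := f2 (C1 ord0 ord0); case fs: (f _) => [[[x y]|[x y]]|[x y]] //= _.
  by left; apply: (direct _ _ _ _ _ _ _ _ _ _ _ _ f_iso); rewrite ?fs.
right; apply: (direct _ _ _ _ _ _ _ _ _ _ _ (@swap_square _ \o f)) => //.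
- by rewrite addnC.
- exact: cylinder_iso_comp f_iso (@swap_iso p'.+1 q'.+1 r'.+1 k' l' a' b' c').
- by rewrite /= fs.
Qed.

(** * One tuple in each isomorphism class *)

Lemma from_abscissa_mod w a (x : 'I_w) :
  from_abscissa (a %% w) x = from_abscissa a x.
Proof.
apply: (can_inj (@iter_ordSK w a)); rewrite from_abscissaK.
rewrite -[RHS](@from_abscissaK w (a %% w)); apply: ord_inj.
by rewrite !val_iter_ordS modnDmr.
Qed.

(** [has_diagram_D] leaves the twists unbounded, whereas [admissible] bounds them. *)
Definition reduce_twists (v : params) : params :=
  let: Params p q r k l alpha beta gamma := v in
  Params p q r k l (alpha %% k) (beta %% (k + l)) (gamma %% l).

Lemma reduce_twists_iso v :
  isomorphic (surface_of v) (surface_of (reduce_twists v)).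
Proof.
case: v => p q r k l a b c; apply/isomorphicP; exists (fun s => s).
split=> [|s|s] //; first by exists (fun s => s).
by case: s => [[[x y]|[x y]]|[x y]] /=; rewrite from_abscissa_mod.
Qed.

Lemma admissible_swap n v : admissible n v -> admissible n (swap v).
Proof.
case: v => p q r k l a b c [[p0 q0 r0 k0 l0] E aP bP cP].
by split=> //=; [rewrite addnC | rewrite addnC].
Qed.

Lemma swap_isomorphic n v : admissible n v ->
  isomorphic (surface_of v) (surface_of (swap v)).
Proof.
case: v => [p q r [|k] [|l] a b c] [[] //] _ _ _ _ _ _ _ _ _.
by apply/isomorphicP; eexists; apply: swap_iso.
Qed.

Lemma Sigma_D_admissible n v : Sigma_D n v -> admissible n v.
Proof. by case=> -[]. Qed.

(** [Sigma_D] says that (k, p, alpha) is at most (l, r, gamma) in the lexicographic order, which is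
    total, and [swap] exchanges the two triples. *)
Lemma Sigma_D_or_swap n v : admissible n v -> Sigma_D n v \/ Sigma_D n (swap v).
Proof.
move=> adm; have adms := admissible_swap adm.
rewrite /Sigma_D /Sigma1 /Sigma2 /Sigma3.
case: v adm adms => p q r k l a b c adm adms /=.
have [kl|kl|kl] := ltngtP k l;
  [by left; constructor 1 | by right; constructor 1 |].
have [pr|pr|pr] := ltngtP p r;
  [by left; constructor 2 | by right; constructor 2 |].
by case: (leqP a c) => [ac|/ltnW ac]; [left|right]; constructor 3.
Qed.

(** By antisymmetry of the lexicographic order, the two triples are equal. *)
Lemma Sigma_D_swap_fixed n v : Sigma_D n v -> Sigma_D n (swap v) -> swap v = v.
Proof.
rewrite /Sigma_D /Sigma1 /Sigma2 /Sigma3.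
case: v => p q r k l a b c /= [[_ H]|[_ [H1 H2]]|[_ [H1 H2 H3]]]
  [[_ G]|[_ [G1 G2]]|[_ [G1 G2 G3]]]; try (exfalso; lia).
by congr Params; lia.
Qed.

Lemma admissible_square_surface n v : admissible n v ->
  square_surface n (surface_of v).
Proof.
case: v => [p q r [|k] [|l] a b c] [[] //] p0 q0 r0 _ _ <- _ _ _.
by split; [apply: card_cylinders | apply: surface_connected].
Qed.

Theorem proposition3p7 (n : nat) (n_gt0 : 0 < n) :
  (forall v : params, Sigma_D n v ->
     [/\ square_surface n (surface_of v), in_H11 (surface_of v)
       & has_diagram_D (surface_of v)]) /\
  (forall S : gluing, square_surface n S -> in_H11 S -> has_diagram_D S ->
     exists! v : params, Sigma_D n v /\ isomorphic S (surface_of v)).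
Proof.
split=> [v /Sigma_D_admissible adm | S [cardS _] _ [v0 pos0 iso0]].
  split; first exact: admissible_square_surface.
    by case: v adm => [p q r [|k] [|l] a b c] [[] //] *; apply: surface_in_H11.
  exists v; first by case: v adm => ? ? ? ? ? ? ? ? [].
  by exists id; split=> //; exists id.
pose v1 := reduce_twists v0.
have iso1 : isomorphic S (surface_of v1).
  exact: isomorphic_trans iso0 (reduce_twists_iso v0).
have adm1 : admissible n v1.
  (* The equation in [admissible] counts squares, and isomorphisms preserve their number. *)
  have cardv1 : #|surface_of v1| = n.
    by have [f [/bij_eq_card <-]] := iso1.
  move: cardv1; rewrite /v1.
  case: v0 pos0 {iso0 v1 iso1} => [p q r [|k] [|l] a b c] [] //.
  move=> p0 q0 r0 _ _ /= card.
  split=> //; rewrite ?ltn_mod //.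
  by rewrite -card; apply/esym; apply: card_cylinders.
have [v Sv iso] : exists2 v, Sigma_D n v & isomorphic S (surface_of v).
  have [Sv|Sv] := Sigma_D_or_swap adm1; first by exists v1.
  exists (swap v1) => //; exact: isomorphic_trans iso1 (swap_isomorphic adm1).
exists v; split=> // w [Sw isow].
have := isomorphic_trans (isomorphic_sym iso) isow.
have [admv admw] := (Sigma_D_admissible Sv, Sigma_D_admissible Sw).
case/(isomorphic_params admv admw) => // vw.
by rewrite vw in Sv *; exact: Sigma_D_swap_fixed Sw Sv.
Qed.
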